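(* Let $G$ be a simple connected graph with order $n(G)\ge 4$. Then $W(G)\geq \varepsilon(G)$. Moreover, equality holds if and only if $G$ is isomorphic to the path $P_4$ or to the cycle $C_4$.
   Context: All graphs are finite, simple and connected. $n(G)$ denotes the number of vertices of $G$. $d_G(u,v)$ is the number of edges on a shortest $u,v$-path. The Wiener index is $W(G)=\sum_{\{u,v\}\subseteq V(G)} d_G(u,v)$ (sum over unordered pairs of vertices). The eccentricity of a vertex $v$ is $\varepsilon_G(v)=\max_{u\in V(G)} d_G(v,u)$, and the eccentricity of the graph is $\varepsilon(G)=\sum_{v\in V(G)}\varepsilon_G(v)$. $P_4$ and $C_4$ are the path and the cycle on $4$ vertices. *)

(* Defs.v *)
From mathcomp Require Import all_boot.

Set Implicit Arguments.
Unset Strict Implicit.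
Unset Printing Implicit Defensive.

(* A simple graph is a symmetric irreflexive relation on a finType. *)

Section Graph.
Variables (T : finType) (e : rel T).

(* x :: p is a path of the graph (no repeated vertex) with k edges. *)
Definition has_path (x y : T) (k : nat) : bool :=
  [exists p : k.-tuple T, [&& path e x p, last x p == y & uniq (x :: p)]].

(* Paths have fewer than #|T| edges, so searching the lengths 0, ..., #|T|.-1
   finds a shortest one; the value is #|T| when x and y are not connected. *)
Definition gdist (x y : T) : nat := find (has_path x y) (iota 0 #|T|).

(* The condition on enum_rank selects each unordered pair of distinct vertices
   exactly once. *)
Definition wiener : nat :=
  \sum_(p : T * T | enum_rank p.1 < enum_rank p.2) gdist p.1 p.2.

Definition eccentricity (v : T) : nat := \max_(u : T) gdist v u.

Definition total_eccentricity : nat := \sum_(v : T) eccentricity v.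

End Graph.

Definition graph_iso (T U : finType) (e : rel T) (f : rel U) : Prop :=
  exists2 h : T -> U, bijective h & {mono h : x y / e x y >-> f x y}.

Definition path_graph (n : nat) : rel 'I_n :=
  [rel i j : 'I_n | (j == i.+1 :> nat) || (i == j.+1 :> nat)].

(* ordS is the successor modulo n; this is the cycle C_n for n >= 3. *)
Definition cycle_graph (n : nat) : rel 'I_n :=
  [rel i j : 'I_n | (j == ordS i) || (i == ordS j)].

(* Main.v *)
Require Import Defs.
From mathcomp Require Import all_boot zify.

(** Let [D v] be the sum of the distances from [v], so that [2 W(G)] is the sum
    of all [D v].  If [v] has eccentricity [k], every distance [0, ..., k] is
    attained from [v], hence [D v >= n - 1 + k (k - 1) / 2], and for [n >= 4]
    this is at least [2 k].  Equality at every vertex forces [n = 4] and the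
    absence of a vertex adjacent to all others; starting from two vertices at
    distance 2, such a graph is seen to be [P_4] or [C_4]. *)

Set Implicit Arguments.
Unset Strict Implicit.
Unset Printing Implicit Defensive.

(** The constant 3 is [n - 1] for [n = 4]; equality holds at [k = 2] and [k = 3]. *)
Lemma leq_double_bin2 k : k.*2 <= 3 + 'C(k, 2).
Proof. by elim: k => // -[|[|k]] // IHk; rewrite binS bin1; lia. Qed.

(** * Distances and shortest paths *)

Section Distance.
Variables (T : finType) (e : rel T).
Hypotheses (e_sym : symmetric e) (e_conn : forall x y : T, connect e x y).

Lemma uniq_size_lt (x : T) p : uniq (x :: p) -> size p < #|T|.
Proof. by move/card_uniqP => /= <-; apply: max_card. Qed.

Lemma gdist_path_le x p : path e x p -> gdist e x (last x p) <= size p.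
Proof.
move=> /shortenP[q e_q q_uniq /uniq_leq_size q_le].
apply: (@leq_trans (size q)); last by apply: q_le; case/andP: q_uniq.
have q_lt := uniq_size_lt q_uniq.
(* A shorter [q] would satisfy [has_path] at an index before the one found. *)
rewrite leqNgt; apply/negP => /(before_find 0).
rewrite nth_iota // add0n => /negbT/negP[].
apply/existsP; exists (in_tuple q).
by rewrite e_q eqxx.
Qed.

(** Connectedness makes the search succeed, which rules out the default value [#|T|]. *)
Lemma gdist_pathP x y :
  exists p, [/\ path e x p, last x p = y & size p = gdist e x y].
Proof.
suff xy_has : has (has_path e x y) (iota 0 #|T|).
  have := nth_find 0 xy_has; rewrite has_find size_iota in xy_has.
  rewrite nth_iota // add0n => /existsP[p /and3P[e_p /eqP xy _]].
  by exists p; rewrite size_tuple.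
have [p e_p ->] := connectP (e_conn x y).
have /shortenP[q e_q q_uniq _] := e_p.
apply/hasP; exists (size q); last first.
  by apply/existsP; exists (in_tuple q); rewrite e_q eqxx.
by rewrite mem_iota; apply: uniq_size_lt q_uniq.
Qed.

Lemma gdistxx x : gdist e x x = 0.
Proof. by apply/eqP; rewrite -leqn0; apply: (@gdist_path_le x [::]). Qed.

Lemma gdist_eq0 x y : (gdist e x y == 0) = (x == y).
Proof.
apply/eqP/eqP => [xy0|->]; last exact: gdistxx.
by have [[|z p] []] := gdist_pathP x y; rewrite xy0.
Qed.

Lemma gdist_edge x y z : e y z -> gdist e x z <= (gdist e x y).+1.
Proof.
move=> yz; have [p [e_p xy <-]] := gdist_pathP x y.
have := @gdist_path_le x (rcons p z).
by rewrite last_rcons size_rcons rcons_path e_p xy; apply.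
Qed.

Lemma gdist_pred x y k :
  gdist e x y = k.+1 -> exists2 z, e z y & gdist e x z = k.
Proof.
move=> xy; have [p [e_p]] := gdist_pathP x y; rewrite xy.
case/lastP: p e_p => // p z; rewrite last_rcons size_rcons rcons_path.
case/andP=> e_p zy z_y [size_p]; rewrite {}z_y in zy.
exists (last x p) => //; apply/eqP; rewrite eqn_leq -{1}size_p gdist_path_le //.
by rewrite -ltnS -xy gdist_edge.
Qed.

Lemma gdist_sym x y : gdist e x y = gdist e y x.
Proof.
wlog suff le_xy : x y / gdist e x y <= gdist e y x.
  by apply/eqP; rewrite eqn_leq !le_xy.
have [p [e_p <- <-]] := gdist_pathP y x.
have := @gdist_path_le (last y p) (rev (belast y p)).
rewrite rev_path (eq_path (e' := e)) // size_rev size_belast.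
suff -> : last (last y p) (rev (belast y p)) = y by apply.
by case: p {e_p} => //= z p; rewrite rev_cons last_rcons.
Qed.

(** Local criterion for checking a closed formula for the distance. Stepping back from [y] with
    [d_pred] bounds [gdist] by [d]; stepping back along a shortest path, with [d_edge], gives the
    converse. *)
Lemma gdist_unique (d : T -> T -> nat) :
    (forall x, d x x = 0) ->
    (forall x y z, e y z -> d x z <= (d x y).+1) ->
    (forall x y, x != y -> exists2 z, e z y & d x y = (d x z).+1) ->
  gdist e =2 d.
Proof.
move=> d0 d_edge d_pred x y; apply/eqP; rewrite eqn_leq; apply/andP; split.
  have [k] := ubnP (d x y); elim: k y => // k IHk y d_le.
  have [<-|/d_pred[z zy dxy]] := eqVneq x y; first by rewrite gdistxx.
  by rewrite dxy (leq_trans (gdist_edge x zy)) // ltnS IHk // -ltnS -dxy.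
have [k] := ubnP (gdist e x y); elim: k y => // k IHk y.
case dxy: (gdist e x y) => [|m] m_le.
  by move/eqP: dxy; rewrite gdist_eq0 => /eqP <-; rewrite d0.
have [z zy dxz] := gdist_pred dxy.
by rewrite (leq_trans (d_edge x z y zy)) // ltnS -dxz IHk // dxz.
Qed.

(** * Sums of distances against eccentricities *)

Lemma wiener_double : (wiener e).*2 = \sum_x \sum_y gdist e x y.
Proof.
rewrite pair_bigA /= (bigID (fun p : T * T => enum_rank p.1 < enum_rank p.2)) /=.
rewrite -addnn; congr addn.
rewrite [RHS](bigID (fun p : T * T => enum_rank p.2 < enum_rank p.1)) /=.
(* The pairs ordered neither way form the diagonal, which contributes 0. *)
rewrite [X in _ + X]big1 ?addn0 => [|[x y] /=]; last first.
  rewrite -!leqNgt -eqn_leq => /eqP/val_inj/enum_rank_inj ->.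
  exact: gdistxx.
pose swap (p : T * T) := (p.2, p.1).
have swapK : involutive swap by case.
rewrite /wiener (reindex_inj (inv_inj swapK)) /=.
apply: eq_big => [[x y]|[x y] _] /=; last exact: gdist_sym.
by case: ltngtP.
Qed.

(** Walking back from a farthest vertex lowers the distance by one at a time. *)
Lemma gdist_surj v k : k <= eccentricity e v -> exists u, gdist e v u == k.
Proof.
have [u ecc_u] : {u | eccentricity e v = gdist e v u}.
  by apply: eq_bigmax; apply/card_gt0P; exists v.
rewrite {}ecc_u; have [m] := ubnP (gdist e v u); elim: m u => // m IHm u.
rewrite ltnS => u_le; rewrite leq_eqVlt => /predU1P[->|]; first by exists u.
case vu: (gdist e v u) => [//|j]; rewrite ltnS => k_le.
have [z _ vz] := gdist_pred vu.
by apply: (IHm z); rewrite vz // -vu.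
Qed.

(** Each vertex other than [v] contributes at least 1. The excesses over 1, on one chosen vertex
    [g i] per distance [i], add up to [0 + 1 + ... + (k - 1)]. *)
Lemma transmission_lower_bound v :
  #|T|.-1 + 'C(eccentricity e v, 2) <= \sum_u gdist e v u.
Proof.
set k := eccentricity e v.
have gP (i : 'I_k.+1) : exists u, gdist e v u == i.
  by apply: gdist_surj; rewrite -ltnS.
pose g i := xchoose (gP i).
have gE i : gdist e v (g i) = i by apply/eqP/(xchooseP (gP i)).
have g_inj : injective g by move=> i j ij; apply/val_inj; rewrite /= -(gE i) ij gE.
have -> : \sum_u gdist e v u = #|T|.-1 + \sum_u (gdist e v u).-1.
  rewrite -(cardC1 v) -sum1_card [X in _ = X + _]big_mkcond -big_split /=.
  apply: eq_bigr => u _; rewrite !inE eq_sym -gdist_eq0.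
  by case: (gdist e v u).
rewrite leq_add2l (bigID (mem (g @: 'I_k.+1))) /= big_imset /=; last first.
  by move=> i j _ _; apply: g_inj.
(* The term of index 0 vanishes since [0.-1 = 0]; the others shift down by one. *)
rewrite big_ord_recl gE add0n -bin2_sum big_mkord.
rewrite [X in _ <= X + _](eq_bigr (fun i : 'I_k => i : nat)) ?leq_addr // => i _.
by rewrite gE.
Qed.

Lemma transmission_ge_double_eccentricity v :
  4 <= #|T| -> (eccentricity e v).*2 <= \sum_u gdist e v u.
Proof.
move=> n_ge4; apply: leq_trans (transmission_lower_bound v).
by have := leq_double_bin2 (eccentricity e v); lia.
Qed.

(** From [n - 1 + 'C(k, 2) <= 2 k <= 3 + 'C(k, 2)] follows [n <= 4], while [k <= 1] would give
    [n - 1 <= 2]. *)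
Lemma transmission_eq_double_eccentricity v :
    4 <= #|T| -> \sum_u gdist e v u = (eccentricity e v).*2 ->
  #|T| = 4 /\ 1 < eccentricity e v.
Proof.
move=> n_ge4 D_eq; have := transmission_lower_bound v.
rewrite D_eq; have := leq_double_bin2 (eccentricity e v).
by case: (eccentricity e v) => [|[|k]]; rewrite ?bin0n ?bin1; lia.
Qed.

Lemma total_eccentricity_double :
  (total_eccentricity e).*2 = \sum_v (eccentricity e v).*2.
Proof. by rewrite -muln2 big_distrl /=; apply: eq_bigr => v _; rewrite muln2. Qed.

Lemma eccentricity_gt1 v :
  1 < eccentricity e v -> exists u, [/\ u != v, ~~ e v u & exists2 w, e v w & e w u].
Proof.
case/gdist_surj=> u /eqP vu; exists u.
rewrite eq_sym -gdist_eq0 vu; split=> //.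
  by apply/negP=> /(gdist_edge v); rewrite gdistxx vu.
have [w wu vw] := gdist_pred vu; exists w => //.
have [z zw /eqP] := gdist_pred vw.
by rewrite gdist_eq0 => /eqP ->.
Qed.

(** * Computing both invariants on a model graph *)

Section Isomorphism.
Variables (n : nat) (f : rel 'I_n) (d : 'I_n -> 'I_n -> nat).
Hypotheses (ef_iso : graph_iso e f)
  (d0 : forall i, d i i = 0)
  (d_edge : forall i j k, f j k -> d i k <= (d i j).+1)
  (d_pred : forall i j, i != j -> exists2 k, f k j & d i j = (d i k).+1).

(** Pulled back along the isomorphism, [d] meets the criterion of [gdist_unique], so both invariants
    become explicit sums over ordinals. *)
Lemma wiener_eccentricity_iso :
  (wiener e).*2 = \sum_i \sum_j d i j /\
  total_eccentricity e = \sum_i \max_j d i j.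
Proof.
have [h [k hK kK] h_mono] := ef_iso.
have h_inj := can_inj hK.
have dE : gdist e =2 fun x y => d (h x) (h y).
  apply: gdist_unique => [x|x y z yz|x y]; first exact: d0.
    by apply: d_edge; rewrite h_mono.
  rewrite -(inj_eq h_inj) => /d_pred[i i_y dxy].
  by exists (k i); rewrite ?kK // -h_mono kK.
have k_bij : {on predT, bijective k} by exists h => x _; rewrite ?hK ?kK.
split.
  rewrite wiener_double (reindex k) //; apply: eq_bigr => i _.
  by rewrite (reindex k) //; apply: eq_bigr => j _; rewrite dE !kK.
rewrite /total_eccentricity (reindex k) //; apply: eq_bigr => i _.
rewrite /eccentricity (reindex k) //; apply: eq_bigr => j _.
by rewrite dE !kK.
Qed.

End Isomorphism.

End Distance.

(** * Recognising the path and the cycle on four vertices *)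

Lemma graph_iso_tnth (T : finType) (e : rel T) n (f : rel 'I_n) (s : n.-tuple T) :
    uniq s -> #|T| = n -> (forall i j, e (tnth s i) (tnth s j) = f i j) ->
  graph_iso e f.
Proof.
move=> /tuple_uniqP s_inj cardT ef.
have [|h sK hK] := inj_card_bij s_inj; first by rewrite cardT card_ord.
by exists h => [|x y]; [exists (tnth s) | rewrite -ef !hK].
Qed.

Ltac case_ord4 i := case: i => [[|[|[|[|//]]]] ?].

Section OrderFour.
Variables (T : finType) (e : rel T).
Hypotheses (e_sym : symmetric e) (e_irr : irreflexive e) (cardT : #|T| = 4).

(** Only the pair [w], [u] is left undecided: an edge closes the cycle, a non-edge leaves the
    path. *)
Lemma four_vertices_iso w a b u :
    uniq [:: w; a; b; u] -> e w a -> e a b -> e b u -> ~~ e w b -> ~~ e a u ->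
  graph_iso e (@path_graph 4) \/ graph_iso e (@cycle_graph 4).
Proof.
move=> s_uniq wa ab bu /negbTE wb /negbTE au.
have [wu|/negbTE wu] := boolP (e w u); [right | left].
all: apply: (@graph_iso_tnth _ _ _ _ [tuple w; a; b; u]) => // i j.
all: rewrite !(tnth_nth w); case_ord4 i; case_ord4 j => /=.
all: by rewrite ?e_irr // ?[e a w]e_sym ?[e b w]e_sym ?[e u w]e_sym
  ?[e b a]e_sym ?[e u a]e_sym ?[e u b]e_sym ?wa ?ab ?bu ?wb ?au ?wu.
Qed.

Lemma no_dominating_vertex_iso :
    (forall x y, connect e x y) -> (forall v, 1 < eccentricity e v) ->
  graph_iso e (@path_graph 4) \/ graph_iso e (@cycle_graph 4).
Proof.
move=> e_conn ecc_gt1.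
have [a _] : exists a, a \in T by apply/card_gt0P; rewrite cardT.
have [u [ua /negbTE au [b ab bu]]] := eccentricity_gt1 e_conn (ecc_gt1 a).
have [w [wb /negbTE bw _]] := eccentricity_gt1 e_conn (ecc_gt1 b).
have wa : w != a by apply: contraFneq bw => ->; rewrite e_sym.
have wu : w != u by apply: contraFneq bw => ->.
have ba : b != a by apply: contraTneq ab => ->; rewrite e_irr.
have bu' : b != u by apply: contraTneq bu => ->; rewrite e_irr.
have s_uniq : uniq [:: w; a; b; u].
  by rewrite /= !inE !negb_or wa wb wu (eq_sym a b) (eq_sym a u) ba ua bu'.
(* Only a neighbour [x] of [w] is kept; it must be [a] or [u]. *)
have [_ [_ _ [x wx _]]] := eccentricity_gt1 e_conn (ecc_gt1 w).
have : x \in [:: w; a; b; u].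
  have /subset_cardP/(_ (subset_predT _))-> // : #|[:: w; a; b; u]| = #|T|.
  by rewrite (card_uniqP s_uniq) cardT.
rewrite !inE => /or4P[] /eqP x_eq; move: wx; rewrite {}x_eq ?e_irr // => wx.
- by apply: four_vertices_iso s_uniq wx ab bu _ _; rewrite ?au // e_sym bw.
- by rewrite e_sym bw in wx.
(* Here the path runs [w], [u], [b], [a]. *)
- apply: (four_vertices_iso _ wx (b := b) (u := a)); rewrite 1?e_sym ?ab ?au ?bu ?bw //.
  by rewrite /= !inE !negb_or wa wb wu (eq_sym u b) ua ba bu'.
Qed.

End OrderFour.

Theorem theorem2p2 (T : finType) (e : rel T)
  (e_sym : symmetric e) (e_irr : irreflexive e)
  (e_conn : forall x y : T, connect e x y) (n_ge4 : 4 <= #|T|) :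
  total_eccentricity e <= wiener e /\
  (wiener e = total_eccentricity e <->
   graph_iso e (@path_graph 4) \/ graph_iso e (@cycle_graph 4)).
Proof.
have D_ge v := transmission_ge_double_eccentricity e_conn v n_ge4.
split.
  rewrite -leq_double wiener_double // total_eccentricity_double.
  by apply: leq_sum => v _.
split=> [W_eq|].
  (* Equal sums of termwise ordered families force equality in every term. *)
  have D_eq v : \sum_u gdist e v u = (eccentricity e v).*2.
    have /eqP := congr1 double W_eq.
    rewrite wiener_double // total_eccentricity_double eq_sym.
    by rewrite (leqif_sum (fun x _ => leqif_eq (D_ge x))) => /forallP/(_ v)/eqP.
  have eq_case v := transmission_eq_double_eccentricity e_conn n_ge4 (D_eq v).
  have [v _] : exists v, v \in T by apply/card_gt0P/(leq_trans _ n_ge4).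
  apply: no_dominating_vertex_iso => //; first by case: (eq_case v).
  by move=> x; case: (eq_case x).
case=> ef_iso; apply: double_inj.
(* Truncated subtraction makes this [|i - j|], the distance in the path. *)
- pose d (i j : 'I_4) := (i - j) + (j - i).
  have [] := wiener_eccentricity_iso e_sym e_conn (d := d) ef_iso.
  + by move=> i; rewrite /d; lia.
  + by move=> i j k /orP[] /eqP /=; rewrite /d; lia.
  + move=> i j; rewrite -val_eqE neq_ltn /= => /orP[] ij.
    * have k_lt : j.-1 < 4 by have := ltn_ord j; lia.
      exists (Ordinal k_lt) => /=; last by rewrite /d /=; lia.
      by apply/orP; left; apply/eqP => /=; lia.
    * have k_lt : j.+1 < 4 by have := ltn_ord i; lia.
      exists (Ordinal k_lt) => /=; last by rewrite /d /=; lia.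
      by apply/orP; right; apply/eqP => /=; lia.
  (* Both doubled invariants evaluate to 20. *)
  by rewrite !big_ord_recl !big_ord0 => -> ->.
(* The length of the shorter of the two arcs of the cycle. *)
- pose d (i j : 'I_4) := minn ((i - j) + (j - i)) (4 - ((i - j) + (j - i))).
  have [] := wiener_eccentricity_iso e_sym e_conn (d := d) ef_iso.
  + by move=> i; rewrite /d; lia.
  + by move=> i j k; case_ord4 i; case_ord4 j; case_ord4 k.
  + move=> i j; case_ord4 i; case_ord4 j => // _;
    solve [by exists (@Ordinal 4 0 isT) | by exists (@Ordinal 4 1 isT)
      | by exists (@Ordinal 4 2 isT) | by exists (@Ordinal 4 3 isT)].
  (* Both doubled invariants evaluate to 16. *)
  by rewrite !big_ord_recl !big_ord0 => -> ->.
Qed.
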